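(* In the affine setting described in the context, let $\sigma\in(0,1]$ and let $f,\alpha,s:I^q\to\mathbb{R}$ be Hölder continuous with exponent $\sigma$, with $s=f$ at the vertices of $I^q$. Let $a=\min\{|a_{k,i}|:1\le k\le q,\ 1\le i\le M_k\}$ and suppose $\max\{\|\alpha\|_\infty/a^\sigma,\ \|\alpha\|_\infty+[\alpha]_\sigma\}<1$. Let $g^{\alpha^g}:I\to\mathbb{R}$, $g^{\alpha^g}(x)=f^\alpha(x,0,\dots,0)$. Then $g^{\alpha^g}$ is Hölder continuous with exponent $\sigma$, and $$1\le\dim_H\mathcal{G}(g^{\alpha^g})\le\underline{\dim}_B\mathcal{G}(g^{\alpha^g})\le\overline{\dim}_B\mathcal{G}(g^{\alpha^g})\le2-\sigma.$$
   Context: Affine setting: $I=[0,1]$; for each $k\in\{1,\dots,q\}$, $M_k\ge2$ and $0=x_{k,0}<\dots<x_{k,M_k}=1$, $I_{k,i}=[x_{k,i-1},x_{k,i}]$. For $1\le i\le M_k$, $u_{k,i}:I\to I_{k,i}$ is affine, $u_{k,i}(x)=a_{k,i}x+b_{k,i}$, with $a_{k,i}=x_{k,i}-x_{k,i-1}$, $b_{k,i}=x_{k,i-1}$ if $i$ is odd and $a_{k,i}=x_{k,i-1}-x_{k,i}$, $b_{k,i}=x_{k,i}$ if $i$ is even. For $i=(i_1,\dots,i_q)$, $u_i(y)=(u_{1,i_1}(y_1),\dots,u_{q,i_q}(y_q))$. Given $f,\alpha,s\in\mathcal{C}(I^q)$ with $\|\alpha\|_\infty<1$ and $s=f$ at the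 vertices of $I^q$, the $\alpha$-fractal function $f^\alpha$ is the unique continuous $f^\alpha:I^q\to\mathbb{R}$ with $f^\alpha(x)=f(x)+\alpha(x)[f^\alpha(u_i^{-1}(x))-s(u_i^{-1}(x))]$ for all $i\in\prod_k\{1,\dots,M_k\}$ and $x\in\prod_k I_{k,i_k}$. Hölder: $|h(x)-h(y)|\le K\|x-y\|_2^\sigma$; $[h]_\sigma=\sup_{x\ne y}|h(x)-h(y)|/\|x-y\|_2^\sigma$. $\mathcal{G}(h)$ is the graph of $h$; $\dim_H,\underline{\dim}_B,\overline{\dim}_B$ are Hausdorff, lower box, upper box dimension. *)

(* Defs.v *)
From HB Require Import structures.
From mathcomp Require Import all_boot all_order all_algebra.
From mathcomp Require Import all_classical all_reals all_analysis.
Set Implicit Arguments. Unset Strict Implicit. Unset Printing Implicit Defensive.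
Import Order.TTheory GRing.Theory Num.Theory.
Import numFieldNormedType.Exports.
Local Open Scope classical_set_scope.
Local Open Scope ring_scope.

Definition cube (R : realType) (q : nat) : set ('I_q -> R) :=
  [set x | forall k, 0 <= x k <= 1].

Definition euclid_dist (R : realType) (q : nat) (x y : 'I_q -> R) : R :=
  Num.sqrt (\sum_(k < q) (x k - y k) ^+ 2).

Definition dist2 (R : realType) (p p' : R * R) : R :=
  Num.sqrt ((p.1 - p'.1) ^+ 2 + (p.2 - p'.2) ^+ 2).

Definition holder_on (R : realType) (T : Type) (d : T -> T -> R) (A : set T)
  (sigma : R) (h : T -> R) : Prop :=
  exists K : R, forall x y, A x -> A y -> `|h x - h y| <= K * (d x y) `^ sigma.

Definition sup_norm (R : realType) (T : Type) (A : set T) (h : T -> R) : R :=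
  sup [set r | exists x, A x /\ r = `|h x|].

Definition holder_seminorm (R : realType) (T : Type) (d : T -> T -> R) (A : set T)
  (sigma : R) (h : T -> R) : R :=
  sup [set r | exists x y, [/\ A x, A y, x <> y & r = `|h x - h y| / (d x y) `^ sigma]].

(* xs is the partition x_{k,0} < ... < x_{k,M_k} of the k-th coordinate *)

Definition acoef (R : realType) (xs : nat -> R) (i : nat) : R :=
  if odd i then xs i - xs i.-1 else xs i.-1 - xs i.

Definition bcoef (R : realType) (xs : nat -> R) (i : nat) : R :=
  if odd i then xs i.-1 else xs i.

Definition umap (R : realType) (xs : nat -> R) (i : nat) (t : R) : R :=
  acoef xs i * t + bcoef xs i.

Definition uinv (R : realType) (xs : nat -> R) (i : nat) (t : R) : R :=
  (t - bcoef xs i) / acoef xs i.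

(* a = min { |a_{k,i}| : 1 <= k <= q, 1 <= i <= M_k }  (all these are <= 1) *)
Definition amin (R : realType) (q : nat) (M : 'I_q -> nat) (xs : 'I_q -> nat -> R) : R :=
  \big[Num.min/1]_(k < q) \big[Num.min/1]_(1 <= i < (M k).+1) `|acoef (xs k) i|.

Definition partitions (R : realType) (q : nat) (M : 'I_q -> nat) (xs : 'I_q -> nat -> R) : Prop :=
  forall k, [/\ (2 <= M k)%N, xs k 0%N = 0, xs k (M k) = 1 &
               forall i, (i < M k)%N -> xs k i < xs k i.+1].

Definition vertex (R : realType) (q : nat) (x : 'I_q -> R) : Prop :=
  forall k, x k = 0 \/ x k = 1.

Definition is_alpha_fractal (R : realType) (q : nat) (M : 'I_q -> nat)
  (xs : 'I_q -> nat -> R) (f alpha s F : ('I_q -> R) -> R) : Prop :=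
  (forall x, @cube R q x -> forall e : R, 0 < e -> exists2 dl : R, 0 < dl &
      forall y, @cube R q y -> euclid_dist x y < dl -> `|F x - F y| < e) /\
  (forall i : 'I_q -> nat, (forall k, (1 <= i k <= M k)%N) ->
   forall x : 'I_q -> R, (forall k, xs k (i k).-1 <= x k <= xs k (i k)) ->
     let y := fun k => uinv (xs k) (i k) (x k) in
     F x = f x + alpha x * (F y - s y)).

Section Dimensions.
Variables (R : realType) (T : Type) (d : T -> T -> R).

(* U has diameter at most delta (in particular U is bounded) *)
Definition diam_le (delta : R) (U : set T) : Prop :=
  forall x y, U x -> U y -> d x y <= delta.

Definition diam (U : set T) : R := sup [set r | exists x y, [/\ U x, U y & r = d x y]].

Definition hcost (s : R) (U : set T) : R :=
  if `[< U = set0 >] then 0 else diam U `^ s.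

Definition hausdorff_content (s delta : R) (E : set T) : \bar R :=
  ereal_inf [set (\sum_(0 <= i <oo) (hcost s (U i))%:E)%E |
             U in [set U : nat -> set T |
                   E `<=` \bigcup_i U i /\ forall i, diam_le delta (U i)]].

(* H^s(E) = lim_{delta -> 0} H^s_delta(E) = sup_{delta > 0} H^s_delta(E) *)
Definition hausdorff_measure (s : R) (E : set T) : \bar R :=
  ereal_sup [set hausdorff_content s delta E | delta in [set delta : R | 0 < delta]].

Definition hausdorff_dim (E : set T) : \bar R :=
  ereal_inf [set s%:E | s in [set s : R | 0 <= s /\ hausdorff_measure s E = 0%E]].

Definition covering_number (delta : R) (E : set T) : \bar R :=
  ereal_inf [set (n%:R)%:E | n in [set n : nat | exists U : nat -> set T,
      E `<=` \bigcup_(i in [set i | (i < n)%N]) U i /\ forall i, diam_le delta (U i)]].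

Definition box_ratio (E : set T) (delta : R) : \bar R :=
  (ln (fine (covering_number delta E)) / - ln delta)%:E.

Definition lower_box_dim (E : set T) : \bar R :=
  ereal_sup [set ereal_inf [set box_ratio E delta | delta in [set delta : R | 0 < delta < eps]]
            | eps in [set eps : R | 0 < eps < 1]].

Definition upper_box_dim (E : set T) : \bar R :=
  ereal_inf [set ereal_sup [set box_ratio E delta | delta in [set delta : R | 0 < delta < eps]]
            | eps in [set eps : R | 0 < eps < 1]].

End Dimensions.

Definition graph01 (R : realType) (g : R -> R) : set (R * R) :=
  [set p | 0 <= p.1 <= 1 /\ p.2 = g p.1].

(* Main.v *)
(** Along the first coordinate axis the self-referential equation closes up:
    the inverse branches fix [0] in the other coordinates, so
    [g t = f t + alpha t * (g (v t) - s (v t))] where [v] glues the inverses of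
    the one-dimensional branches.  Because consecutive branches reverse
    orientation, [v] is Lipschitz with constant [1/a].  Iterating, with
    [||alpha|| / a^sigma < 1], gives Hölder continuity of [g].  A column of
    width [delta] then meets the graph in [O(delta^(sigma-1))] squares, whence
    the upper bound [2 - sigma]; projecting to the first coordinate and
    comparing with Lebesgue measure gives the lower bound [1]. *)

Require Import Defs.
From HB Require Import structures.
From mathcomp Require Import all_boot all_order all_algebra.
From mathcomp Require Import all_classical all_reals all_analysis.
From mathcomp Require Import ring lra.
Import Order.TTheory GRing.Theory Num.Theory.
Import numFieldNormedType.Exports.
Local Open Scope classical_set_scope.
Local Open Scope ring_scope.

(** * Partitions of an interval and the glued inverse branches *)

Lemma partition_cell (R : realType) (M : nat) (x : nat -> R) (t : R) :
  (0 < M)%N -> x 0%N <= t <= x M ->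
  exists2 i, (i < M)%N & x i <= t <= x i.+1.
Proof.
elim: M => // -[_ _ ht|M IH _ /andP[t0 tM]]; first by exists 0%N.
have [tle|tgt] := leP t (x M.+1).
  by have [|i iM hi] := IH isT; [rewrite t0|exists i; rewrite ?hi ?(ltnW iM) // ltnW].
by exists M.+1; rewrite ?ltnSn // tM ltW.
Qed.

Lemma partition_homo (R : realType) (M : nat) (x : nat -> R) (i j : nat) :
  (forall k, (k < M)%N -> x k < x k.+1) -> (i <= j)%N -> (j <= M)%N -> x i <= x j.
Proof.
move=> hx; elim: j => [|j IH]; first by rewrite leqn0 => /eqP ->.
rewrite leq_eqVlt => /predU1P[-> //|ij jM].
by rewrite (le_trans (IH ij (ltnW jM))) // ltW // hx.
Qed.

(** Indices shift by one, so [odd i] singles out an even-numbered branch [i.+1], one that reverses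
    orientation. *)
Lemma uinvSE (R : realType) (x : nat -> R) (i : nat) (t : R) :
  uinv x i.+1 t = if odd i then (x i.+1 - t) / (x i.+1 - x i)
                  else (t - x i) / (x i.+1 - x i).
Proof.
rewrite /uinv /acoef /bcoef /=; case: (odd i) => //=.
by rewrite -[x i - _]opprB invrN mulrN -mulNr opprB.
Qed.

Lemma uinv_itv (R : realType) (x : nat -> R) (i : nat) (t : R) :
  x i < x i.+1 -> x i <= t <= x i.+1 -> 0 <= uinv x i.+1 t <= 1.
Proof.
move=> hx /andP[h1 h2]; have w0 : 0 < x i.+1 - x i by rewrite subr_gt0.
rewrite uinvSE; case: ifP => _; rewrite divr_ge0 ?subr_ge0 ?(ltW hx) //=;
by rewrite ler_pdivrMr // mul1r; lra.
Qed.

(* Consecutive [u_{k,i}] have opposite orientation, so their inverses agree at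
   the common endpoint: glued together, they form one Lipschitz map. *)
Lemma uinv_lipschitz (R : realType) (M : nat) (x : nat -> R) (a : R)
    (i j : nat) (t t' : R) :
  0 < a -> (forall k, (k < M)%N -> a <= x k.+1 - x k) ->
  (i < M)%N -> (j < M)%N -> x i <= t <= x i.+1 -> x j <= t' <= x j.+1 ->
  a * `|uinv x i.+1 t - uinv x j.+1 t'| <= `|t - t'|.
Proof.
move=> a0 ha.
have hx k : (k < M)%N -> x k < x k.+1 by move=> /ha; lra.
have scale k d : (k < M)%N -> 0 <= d -> 0 <= d / (x k.+1 - x k) /\
    a * (d / (x k.+1 - x k)) <= d.
  move=> kM d0; have w0 : 0 < x k.+1 - x k by rewrite subr_gt0 hx.
  split; first by rewrite divr_ge0 // ltW.
  by rewrite mulrA ler_pdivrMr // mulrC ler_wpM2l // ha.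
wlog ij : i j t t' / (i <= j)%N.
  move=> H iM jM ht ht'; case: (leqP i j) => [|/ltnW] ij; first exact: H.
  by rewrite distrC [`|t - _|]distrC; exact: H.
move=> iM jM /[dup] ht /andP[t1 t2] /[dup] ht' /andP[t'1 t'2].
(* Three cases: same cell, adjacent cells, cells further apart. The first is treated here: both
   inverses are then one affine map. *)
case: (ltngtP i j) ij => // [ij _|ij _]; last first.
  subst j.
  have -> : `|uinv x i.+1 t - uinv x i.+1 t'| = `|t - t'| / (x i.+1 - x i).
    have w0 : 0 < x i.+1 - x i by rewrite subr_gt0 hx.
    rewrite -[X in _ / X]gtr0_norm // -normf_div !uinvSE; case: ifP => _.
      by rewrite -normrN; congr (`|_|); field; rewrite gt_eqF.
    by congr (`|_|); field; rewrite gt_eqF.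
  by have [] := scale i `|t - t'| iM (normr_ge0 _).
have tt' : t <= t'.
  by rewrite (le_trans t2) // (le_trans _ t'1) // (@partition_homo _ M) // ltnW.
rewrite [`|t - _|]distrC [`|t' - t|]ger0_norm ?subr_ge0 //.
move: ij; rewrite leq_eqVlt => /predU1P[ij|ij].
  subst j.
  have [X0 aX] := scale i (x i.+1 - t) iM ltac:(lra).
  have [Y0 aY] := scale i.+1 (t' - x i.+1) jM ltac:(lra).
  (* Both inverses take the same value, 0 or 1, at [x i.+1]; passing through that value bounds the
     gap by the sum of the two scaled distances to [x i.+1]. *)
  have : `|uinv x i.+1 t - uinv x i.+2 t'| <=
     (x i.+1 - t) / (x i.+1 - x i) + (t' - x i.+1) / (x i.+2 - x i.+1).
    set X := (x i.+1 - t) / _ in X0 *; set Y := (t' - x i.+1) / _ in Y0 *.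
    have w0 : 0 < x i.+1 - x i by rewrite subr_gt0 hx.
    have w'0 : 0 < x i.+2 - x i.+1 by rewrite subr_gt0 hx.
    rewrite !uinvSE /=; case: ifP => _ /=; last first.
      have -> : (t - x i) / (x i.+1 - x i) = 1 - X.
        by rewrite /X; field; rewrite gt_eqF.
      have -> : (x i.+2 - t') / (x i.+2 - x i.+1) = 1 - Y.
        by rewrite /Y; field; rewrite gt_eqF.
      by rewrite ler_norml; lra.
    by rewrite -/X -/Y ler_norml; lra.
  by move=> h; rewrite (le_trans (ler_wpM2l (ltW a0) h)) // mulrDr; lra.
(* A whole cell lies between the two points, while both inverse values lie in [0, 1] and so differ
   by at most 1. *)
have aj : a <= t' - t.
  case: j ij jM {ht'} t'1 t'2 => // j ij jM t'1 t'2.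
  have := ha j (ltnW jM).
  have : x i.+1 <= x j by apply: (@partition_homo _ M) => //; exact: ltnW (ltnW jM).
  lra.
rewrite (le_trans _ aj) // ler_piMr ?(ltW a0) //.
have := @uinv_itv _ x i t (hx _ iM) ht; have := @uinv_itv _ x j t' (hx _ jM) ht'.
by rewrite ler_norml; lra.
Qed.

(** * Hölder continuity from a self-affine inequality *)

Lemma geometric_lt_pos (R : realType) (A c e : R) :
  0 <= A < 1 -> 0 < e -> exists n, c * A ^+ n < e.
Proof.
move=> /andP[A0 A1] e0.
have /cvgrPdist_lt /(_ e e0) : geometric c A n @[n --> \oo] --> (0 : R).
  by apply: cvg_geometric; rewrite ger0_norm.
case=> n _ /(_ n (leqnn n)); rewrite /= sub0r normrN => h.
by exists n; apply: le_lt_trans h; rewrite ler_norm.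
Qed.

(* Unfolding the inequality n times leaves a geometric sum and the remainder
   [2 B A^n], which is arbitrarily small. *)
Lemma holder_of_self_affine (R : realType) (D : set R) (h : R -> R)
    (sigma a A B K : R) :
  0 < a -> 0 <= A < 1 -> A / a `^ sigma < 1 -> 0 <= K -> 0 <= sigma ->
  (forall x, D x -> `|h x| <= B) ->
  (forall x y, D x -> D y -> exists x' y', [/\ D x', D y',
     a * `|x' - y'| <= `|x - y| &
     `|h x - h y| <= K * `|x - y| `^ sigma + A * `|h x' - h y'| ]) ->
  forall x y, D x -> D y ->
    `|h x - h y| <= K / (1 - A / a `^ sigma) * `|x - y| `^ sigma.
Proof.
move=> a0 A01 Aa K0 s0 hB hh x y Dx Dy.
have as0 : 0 < a `^ sigma by exact: powR_gt0.
set C := K / _.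
have C0 : 0 <= C by rewrite mulr_ge0 // invr_ge0 subr_ge0 ltW.
(* [C] is the fixed point of one unfolding, so the induction below reproduces it exactly. *)
have CE : K + A * (C / a `^ sigma) = C.
  by rewrite /C; field; rewrite !gt_eqF //= subr_gt0; move: Aa; rewrite ltr_pdivrMr ?mul1r.
clearbody C.
have iter n : forall x y, D x -> D y ->
    `|h x - h y| <= C * `|x - y| `^ sigma + 2 * B * A ^+ n.
  elim: n => [|n IH] {Dx Dy x y} x y Dx Dy.
    rewrite expr0 mulr1 ler_wpDl ?mulr_ge0 ?powR_ge0 //.
    by apply: le_trans (ler_normB _ _) _; rewrite mulrDl mul1r lerD ?hB.
  have [x' [y' [Dx' Dy' hd hxy]]] := hh _ _ Dx Dy; apply: le_trans hxy _.
  have /andP[A0 _] := A01.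
  have : `|x' - y'| `^ sigma <= `|x - y| `^ sigma / a `^ sigma.
    rewrite ler_pdivlMr // -powRM ?(ltW a0) // mulrC.
    by rewrite ge0_ler_powR ?nnegrE ?mulr_ge0 ?(ltW a0).
  move=> /(ler_wpM2l C0) hd'.
  have hle := ler_wpM2l A0 (le_trans (IH _ _ Dx' Dy') (lerD hd' (lexx _))).
  apply: le_trans (lerD (lexx _) hle) _.
  by rewrite -[in leRHS]CE exprS le_eqVlt; apply/orP; left; apply/eqP; ring.
apply/ler_addgt0Pr => e e0.
have [n hn] := geometric_lt_pos R A (2 * B) e A01 e0.
by apply: le_trans (iter n _ _ Dx Dy) _; rewrite lerD2l ltW.
Qed.

(** * The fractal function along the first coordinate axis *)

Definition axis (R : realType) (q : nat) (t : R) : 'I_q -> R :=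
  fun k => if val k == 0%N then t else 0.

Lemma euclid_dist_axis (R : realType) (q : nat) (x y : R) :
  (0 < q)%N -> euclid_dist (axis R q x) (axis R q y) = `|x - y|.
Proof.
move=> q0; rewrite /euclid_dist (bigD1 (Ordinal q0)) //= big1 ?addr0.
  by rewrite sqrtr_sqr.
move=> k /negP k0; rewrite /axis; case: eqP => [k0'|_].
  by exfalso; apply: k0; apply/eqP/val_inj.
by rewrite subrr expr0n.
Qed.

Lemma cube_axis (R : realType) (q : nat) (t : R) :
  0 <= t <= 1 -> @cube R q (axis R q t).
Proof. by move=> ht k; rewrite /axis; case: ifP => // _; rewrite lexx ler01. Qed.

Lemma holder_on_nneg (R : realType) (T : Type) (d : T -> T -> R) (A : set T)
    (sigma : R) (h : T -> R) :
  holder_on d A sigma h ->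
  exists2 K, 0 <= K & forall x y, A x -> A y -> `|h x - h y| <= K * (d x y) `^ sigma.
Proof.
case=> K hK; exists `|K| => // x y Ax Ay.
by apply: le_trans (hK _ _ Ax Ay) _; rewrite ler_wpM2r ?powR_ge0 ?ler_norm.
Qed.

(** A real [sup] defaults to 0 on unbounded sets, so boundedness has to be established: every point
    of the cube is within [Num.sqrt q%:R] of the origin, which limits the variation of a Hölder
    function. *)
Lemma holder_cube_le_sup_norm (R : realType) (q : nat) (sigma : R)
    (h : ('I_q -> R) -> R) (x : 'I_q -> R) :
  0 <= sigma -> holder_on (@euclid_dist R q) (@cube R q) sigma h ->
  @cube R q x -> `|h x| <= sup_norm (@cube R q) h.
Proof.
move=> s0 /holder_on_nneg[K K0 hK] cx; apply: ub_le_sup; last by exists x.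
exists (`|h (fun=> 0)| + K * (Num.sqrt q%:R) `^ sigma) => _ [y [cy ->]].
have c0 : @cube R q (fun=> 0) by move=> k; rewrite lexx ler01.
rewrite -lerBlDl (le_trans (lerB_dist _ _)) // (le_trans (hK _ _ cy c0)) //.
rewrite ler_wpM2l // ge0_ler_powR ?nnegrE ?sqrtr_ge0 // ler_wsqrtr //.
rewrite -[q in q%:R]card_ord -sum1_card natr_sum ler_sum // => k _.
rewrite subr0; have /andP[y0 y1] := cy k.
by rewrite expr_le1.
Qed.

(** The extreme value theorem applied to the absolute value of [h]. It supplies the a priori bound
    [B] that the iteration of the self-affine inequality starts from. *)
Lemma continuous_bounded_itv (R : realType) (h : R -> R) :
  (forall x, 0 <= x <= 1 -> forall e : R, 0 < e -> exists2 dl : R, 0 < dl &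
     forall y, 0 <= y <= 1 -> `|x - y| < dl -> `|h x - h y| < e) ->
  exists B, forall x, 0 <= x <= 1 -> `|h x| <= B.
Proof.
move=> hc.
have [] := @EVT_max R (fun t => `|h t|) 0 1 ler01.
  apply/subspace_continuousP => x; rewrite /= in_itv /= => x01.
  apply/cvgrPdist_lt => e /(hc x x01)[dl dl0 hdl].
  rewrite near_withinE; near=> y; rewrite /= in_itv /= => y01.
  apply: le_lt_trans (hdl y y01 _); first exact: ler_dist_dist.
  by near: y; apply: cvgr_dist_lt.
move=> c _ hM; exists `|h c| => x x01; apply: hM.
by rewrite in_itv.
Unshelve. all: by end_near.
Qed.

Lemma amin_gt0 (R : realType) (q : nat) (M : 'I_q -> nat) (xs : 'I_q -> nat -> R) :
  partitions M xs -> 0 < amin M xs.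
Proof.
move=> hp; apply: lt_bigmin => // k _; rewrite big_nat_cond.
apply: lt_bigmin => // -[//|i] /andP[/andP[_ iM] _].
have [_ _ _ /(_ i) hi] := hp k.
have {}hi := hi iM.
by rewrite normr_gt0 /acoef /=; case: ifP => _; rewrite subr_eq0; move: hi;
  case: ltgtP.
Qed.

Lemma amin_le (R : realType) (q : nat) (M : 'I_q -> nat) (xs : 'I_q -> nat -> R)
    (k : 'I_q) (i : nat) :
  partitions M xs -> (i < M k)%N -> amin M xs <= xs k i.+1 - xs k i.
Proof.
move=> hp iM; have [_ _ _ /(_ i iM) hi] := hp k.
apply: le_trans (bigmin_le _ k _) _.
apply: (bigmin_inf_seq _ i.+1) => //; first by rewrite mem_index_iota.
rewrite /acoef /=; case: ifP => _; [|rewrite distrC]; rewrite gtr0_norm ?subr_gt0 //.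
Qed.

Lemma amin_le1 (R : realType) (q : nat) (M : 'I_q -> nat) (xs : 'I_q -> nat -> R) :
  amin M xs <= 1.
Proof. exact: bigmin_le_id. Qed.

(** The first branch of every coordinate is increasing and starts at 0, so its inverse fixes 0.
    Choosing cell 1 in every coordinate other than [k0] therefore keeps the preimage on the axis. *)
Lemma fractal_axis_eq (R : realType) (q : nat) (M : 'I_q -> nat)
    (xs : 'I_q -> nat -> R) (f alpha s F : ('I_q -> R) -> R) (k0 : 'I_q)
    (i : nat) (t : R) :
  val k0 = 0%N -> partitions M xs -> is_alpha_fractal M xs f alpha s F ->
  (i < M k0)%N -> xs k0 i <= t <= xs k0 i.+1 ->
  let t' := uinv (xs k0) i.+1 t in
  F (axis R q t) = f (axis R q t) +
    alpha (axis R q t) * (F (axis R q t') - s (axis R q t')).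
Proof.
move=> vk0 hp [_ hF] iM ht t'.
have k0E k : (val k == 0%N) = (k == k0) by rewrite -vk0.
rewrite (hF (fun k => if k == k0 then i.+1 else 1%N)) /=; first last.
- move=> k; rewrite /axis k0E; case: eqP => [->//|_].
  have [M2 x0 _ /(_ 0%N) hx] := hp k.
  by rewrite /= x0 lexx -x0 ltW // hx // ltnW.
- by move=> k; case: eqP => [->//|_]; have [/ltnW ->] := hp k.
suff -> : (fun k => uinv (xs k) (if k == k0 then i.+1 else 1%N) (axis R q t k))
    = axis R q t' by [].
apply/funext => k; rewrite /axis k0E; case: eqP => [->//|_].
by have [_ x0 _ _] := hp k; rewrite uinvSE /= x0 subrr mul0r.
Qed.

(** Subtracting the fractal equations at two points, each with its own cell, leaves a Hölder term
    plus [A] times the difference at the preimages: the hypothesis of [holder_of_self_affine]. *)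
Lemma fractal_axis_holder (R : realType) (q : nat) (M : 'I_q -> nat)
    (xs : 'I_q -> nat -> R) (sigma : R) (f alpha s F : ('I_q -> R) -> R) :
  (0 < q)%N -> partitions M xs -> 0 < sigma ->
  holder_on (@euclid_dist R q) (@cube R q) sigma f ->
  holder_on (@euclid_dist R q) (@cube R q) sigma alpha ->
  holder_on (@euclid_dist R q) (@cube R q) sigma s ->
  sup_norm (@cube R q) alpha / (amin M xs) `^ sigma < 1 ->
  is_alpha_fractal M xs f alpha s F ->
  holder_on (fun x y : R => `|x - y|) [set t : R | 0 <= t <= 1] sigma
    (fun t => F (axis R q t)).
Proof.
move=> q0 hp s0 hf halpha hs; set A := sup_norm _ _; set a := amin _ _.
move=> Aa hF; pose k0 := Ordinal q0.
have a0 : 0 < a by exact: amin_gt0.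
have alphaA t : 0 <= t <= 1 -> `|alpha (axis R q t)| <= A.
  by move=> ht; apply: holder_cube_le_sup_norm halpha _; [exact: ltW|exact: cube_axis].
(* [A] is below the power of [a] with exponent [sigma], which is at most 1 because [amin] is at most
   1. *)
have A01 : 0 <= A < 1.
  rewrite (le_trans (normr_ge0 _) (alphaA 0 _)) ?lexx ?ler01 //=.
  move: Aa; rewrite ltr_pdivrMr ?powR_gt0 // mul1r => /lt_le_trans; apply.
  rewrite (_ : 1 = 1 `^ sigma); last by rewrite powR1.
  rewrite ge0_ler_powR ?nnegrE ?(ltW a0) ?(ltW s0) //.
  exact: amin_le1.
have [Kf Kf0 hKf] := holder_on_nneg _ _ _ _ _ _ hf.
have [Ka Ka0 hKa] := holder_on_nneg _ _ _ _ _ _ halpha.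
have [Ks Ks0 hKs] := holder_on_nneg _ _ _ _ _ _ hs.
have [B hB] : exists B, forall x, 0 <= x <= 1 -> `|F (axis R q x)| <= B.
  apply: continuous_bounded_itv => x x01 e e0; have [hc _] := hF.
  have [dl dl0 h] := hc _ (cube_axis R q x x01) e e0.
  exists dl => // y y01 xy; apply: h; first exact: cube_axis.
  by rewrite euclid_dist_axis.
pose S := sup_norm (@cube R q) s.
have hS t : 0 <= t <= 1 -> `|s (axis R q t)| <= S.
  by move=> ht; apply: holder_cube_le_sup_norm hs _; [exact: ltW|exact: cube_axis].
have B0 : 0 <= B + S.
  rewrite addr_ge0 //; [apply: le_trans (hB 0 _)|apply: le_trans (hS 0 _)];
  by rewrite ?lexx ?ler01.
have [M2 x0 xM hx] := hp k0.
have /andP[A0 _] := A01.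
have as0 : 0 < a `^ sigma by exact: powR_gt0.
(* Three sources of variation: [f]; [alpha], against the bound [B + S] on [F - s]; and [s] at the
   preimages, whose distance grows by a factor of at most [1 / a]. *)
set K := Kf + Ka * (B + S) + A * (Ks / a `^ sigma).
have K0 : 0 <= K.
  by rewrite addr_ge0 ?addr_ge0 ?(mulr_ge0 Ka0 B0) // mulr_ge0 // mulr_ge0 // invr_ge0 ltW.
exists (K / (1 - A / a `^ sigma)).
apply: (holder_of_self_affine _ _ _ _ _ _ B) => //; first exact: ltW.
move=> x y x01 y01.
have cell t : 0 <= t <= 1 -> exists2 i, (i < M k0)%N & xs k0 i <= t <= xs k0 i.+1.
  by move=> ht; apply: partition_cell; [exact: ltnW|rewrite x0 xM].
have [i iM hi] := cell _ x01; have [j jM hj] := cell _ y01.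
set x' := uinv (xs k0) i.+1 x; set y' := uinv (xs k0) j.+1 y.
have x'01 : 0 <= x' <= 1 by apply: uinv_itv hi; exact: hx.
have y'01 : 0 <= y' <= 1 by apply: uinv_itv hj; exact: hx.
have lip : a * `|x' - y'| <= `|x - y|.
  apply: (uinv_lipschitz _ (M k0)) => // k kM; exact: amin_le.
exists x', y'; split=> //.
rewrite (fractal_axis_eq R q M xs f alpha s F k0 i x) // -/x'.
rewrite (fractal_axis_eq R q M xs f alpha s F k0 j y) // -/y'.
set gx := F (axis R q x'); set gy := F (axis R q y').
set d := `|x - y| `^ sigma.
have := hKf _ _ (cube_axis R q x x01) (cube_axis R q y y01).
have := hKa _ _ (cube_axis R q x x01) (cube_axis R q y y01).
have := hKs _ _ (cube_axis R q x' x'01) (cube_axis R q y' y'01).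
rewrite !euclid_dist_axis // -/d => hs' ha' hf'.
have {}hs' : `|s (axis R q x') - s (axis R q y')| <= Ks / a `^ sigma * d.
  rewrite (le_trans hs') // -mulrA ler_wpM2l // mulrC ler_pdivlMr // mulrC -powRM ?(ltW a0) //.
  by rewrite ge0_ler_powR ?nnegrE ?mulr_ge0 ?(ltW a0) ?(ltW s0).
have hb : `|gy - s (axis R q y')| <= B + S.
  by apply: le_trans (ler_normB _ _) _; rewrite lerD // ?hB ?hS.
move: (alphaA x x01) ha' hf' hs' hb.
set fx := f _; set fy := f _; set ax := alpha _; set ay := alpha _.
set sx := s _; set sy := s _ => hax ha' hf' hs' hb.
(* The difference of products is split so that [alpha] varies against the bracket at [y'], and the
   bracket varies against [alpha] at [x]. *)
have -> : fx + ax * (gx - sx) - (fy + ay * (gy - sy)) =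
  (fx - fy) + (ax - ay) * (gy - sy) + (ax * (gx - gy) - ax * (sx - sy)) by ring.
have -> : K * d + A * `|gx - gy| =
  Kf * d + (Ka * d) * (B + S) + (A * `|gx - gy| + A * (Ks / a `^ sigma * d)).
  by rewrite /K; ring.
apply: le_trans (ler_normD _ _) _; rewrite lerD //.
  by apply: le_trans (ler_normD _ _) _; rewrite lerD // normrM ler_pM.
by rewrite (le_trans (ler_normB _ _)) // !normrM lerD // ler_pM.
Qed.

(** * Diameters, covering numbers and the general dimension inequalities *)

Lemma le_diam (R : realType) (T : Type) (d : T -> T -> R) (delta : R) (U : set T) x y :
  diam_le d delta U -> U x -> U y -> d x y <= diam d U.
Proof.
move=> hU Ux Uy; apply: ub_le_sup; last by exists x, y.
by exists delta => _ [x' [y' [Ux' Uy' ->]]]; exact: hU.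
Qed.

Lemma diam_le_diam (R : realType) (T : Type) (d : T -> T -> R) (delta : R) (U : set T) x :
  diam_le d delta U -> U x -> diam d U <= delta.
Proof.
move=> hU Ux; apply: ge_sup; first by exists (d x x), x, x.
by move=> _ [x' [y' [Ux' Uy' ->]]]; exact: hU.
Qed.

Lemma hcost_ge0 (R : realType) (T : Type) (d : T -> T -> R) (s : R) (U : set T) :
  0 <= hcost d s U.
Proof. by rewrite /hcost; case: ifP => // _; rewrite powR_ge0. Qed.

Lemma hcost_le (R : realType) (T : Type) (d : T -> T -> R) (s delta : R) (U : set T) :
  (forall x y, 0 <= d x y) -> 0 <= s -> diam_le d delta U ->
  hcost d s U <= delta `^ s.
Proof.
move=> d0 s0 hU; rewrite /hcost; case: asboolP => [_|/eqP/set0P[x Ux]].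
  exact: powR_ge0.
have D0 : 0 <= diam d U by rewrite (le_trans (d0 x x)) // (@le_diam _ _ _ delta).
have Dd := diam_le_diam _ _ _ _ _ _ hU Ux.
by rewrite ge0_ler_powR ?nnegrE // (le_trans D0).
Qed.

(** Any two thresholds admit a common smaller scale; the ratio there lies above the infimum for one
    and below the supremum for the other. *)
Lemma lower_box_dim_le_upper (R : realType) (T : Type) (d : T -> T -> R) (E : set T) :
  (lower_box_dim d E <= upper_box_dim d E)%E.
Proof.
apply: ge_ereal_sup => _ [e1 /= /andP[e10 e11] <-].
apply: le_ereal_inf_tmp => _ [e2 /= /andP[e20 e21] <-].
pose dl := Num.min e1 e2 / 2.
have m0 : 0 < Num.min e1 e2 by rewrite lt_min e10.
have m2 : dl < Num.min e1 e2 by rewrite /dl; lra.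
have dl0 : 0 < dl by rewrite divr_gt0.
move: m2; rewrite lt_min => /andP[d1 d2].
apply: (@le_trans _ _ (box_ratio d E dl)).
  by apply: ereal_inf_lbound; exists dl; rewrite //= dl0.
by apply: ereal_sup_ubound; exists dl; rewrite //= dl0.
Qed.

(** Counts are natural numbers, so one finite cover turns the infimum into a minimum; [fine] in
    [box_ratio] then returns a genuine count, not its default at infinity. *)
Lemma covering_numberP (R : realType) (T : Type) (d : T -> T -> R) (delta : R)
    (E : set T) (n : nat) (U : nat -> set T) :
  E `<=` \bigcup_(i in [set i | (i < n)%N]) U i ->
  (forall i, diam_le d delta (U i)) ->
  exists N V, [/\ (N <= n)%N, covering_number d delta E = (N%:R)%:E,
    E `<=` \bigcup_(i in [set i | (i < N)%N]) V i &
    forall i, diam_le d delta (V i)].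
Proof.
move=> EU hU.
pose P n := `[< exists U : nat -> set T,
  E `<=` \bigcup_(i in [set i | (i < n)%N]) U i /\ forall i, diam_le d delta (U i)>].
have exP : exists n, P n by exists n; apply/asboolP; exists U.
case: (ex_minnP exP) => N /asboolP[V [EV hV]] hmin.
exists N, V; split=> //; first by apply: hmin; apply/asboolP; exists U.
apply/eqP; rewrite eq_le; apply/andP; split.
  by apply: ereal_inf_lbound; exists N => //; exists V.
apply: le_ereal_inf_tmp => _ [m [W hW] <-].
by rewrite lee_fin ler_nat hmin //; apply/asboolP; exists W.
Qed.

(** Rules out a negative or infinitely negative value, so that a finite lower box dimension can
    serve as a Hausdorff exponent. *)
Lemma lower_box_dim_ge0 (R : realType) (T : Type) (d : T -> T -> R) (E : set T) :
  (forall delta : R, 0 < delta -> exists (n : nat) (U : nat -> set T),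
    E `<=` \bigcup_(i in [set i | (i < n)%N]) U i /\ forall i, diam_le d delta (U i)) ->
  (0 <= lower_box_dim d E)%E.
Proof.
move=> tb; apply: le_ereal_sup_tmp.
exists (ereal_inf [set box_ratio d E delta | delta in [set delta : R | 0 < delta < 2^-1]]).
  by exists 2^-1 => //=; lra.
apply: le_ereal_inf_tmp => _ [dl /= /andP[dl0 dl1] <-].
have [n [U [EU hU]]] := tb _ dl0.
have [N [V [_ NE _ _]]] := covering_numberP _ _ _ _ _ _ _ EU hU.
rewrite /box_ratio NE /= lee_fin divr_ge0 //; last first.
  by rewrite oppr_ge0 ltW // ln_lt0 //; lra.
(* A count of 0 is harmless because [ln 0] is 0 by convention. *)
by case: N {NE} => [|N]; [rewrite ln0|rewrite ln_ge0 // ler1n].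
Qed.

Lemma hausdorff_content_le (R : realType) (T : Type) (d : T -> T -> R)
    (s delta delta' : R) (E : set T) (n : nat) (U : nat -> set T) :
  (forall x y, 0 <= d x y) -> 0 <= s -> 0 < delta <= delta' ->
  E `<=` \bigcup_(i in [set i | (i < n)%N]) U i ->
  (forall i, diam_le d delta (U i)) ->
  (hausdorff_content d s delta' E <= (n%:R * delta `^ s)%:E)%E.
Proof.
move=> d0 s0 /andP[dl0 dl'] EU hU.
(* Padding with empty sets makes the cover a sequence. [hcost] charges them 0 explicitly, since at
   exponent 0 their diameter 0 would have power 1. *)
pose V i := if (i < n)%N then U i else set0.
have V0 i : ~~ (i < n)%N -> V i = set0 by rewrite /V => /negPf ->.
apply: ge_ereal_inf; exists (\sum_(0 <= i <oo) (hcost d s (V i))%:E)%E.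
  exists V => //; split.
    by move=> x /EU[i /= iN Uix]; exists i => //; rewrite /V iN.
  move=> i; rewrite /V; case: ifP => _ x y Ux Uy; last by case: Ux.
  by rewrite (le_trans (hU i x y Ux Uy)).
rewrite (nneseries_split 0%N n); last by move=> k _; rewrite lee_fin hcost_ge0.
rewrite add0n [X in (_ + X)%E]eseries0 ?adde0; last first.
  move=> i ni _; rewrite V0 -?leqNgt // /hcost; case: asboolP => //.
rewrite sumEFin lee_fin big_mkord.
apply: (@le_trans _ _ (\sum_(i < n) delta `^ s)); last first.
  by rewrite sumr_const card_ord mulr_natl.
by apply: ler_sum => i _; apply: hcost_le; rewrite // /V ltn_ord.
Qed.

(** If l is the lower box dimension, some arbitrarily small scales d need at most d^-(l + e/2) sets.
    Their cost at exponent l + e is at most d^(e/2), which tends to 0, so the measure at exponent l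
    + e vanishes for every e > 0. *)
Lemma hausdorff_dim_le_lower_box (R : realType) (T : Type) (d : T -> T -> R) (E : set T) :
  (forall x y, 0 <= d x y) ->
  (forall delta : R, 0 < delta -> exists (n : nat) (U : nat -> set T),
    E `<=` \bigcup_(i in [set i | (i < n)%N]) U i /\ forall i, diam_le d delta (U i)) ->
  (hausdorff_dim d E <= lower_box_dim d E)%E.
Proof.
move=> d0 tb; have := lower_box_dim_ge0 _ _ _ _ tb.
case E0 : (lower_box_dim d E) => [l||] //; last by move=> _; rewrite leey.
rewrite lee_fin => l0; apply/lee_addgt0Pr => e e0.
apply: ereal_inf_lbound; exists (l + e) => //=.
have le0 : 0 <= l + e by lra.
split=> //; apply/eqP; rewrite eq_le; apply/andP; split; last first.
  apply: le_ereal_sup_tmp; exists (hausdorff_content d (l + e) 1 E).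
    by exists 1 => //=.
  apply: le_ereal_inf_tmp => _ [U _ <-].
  by apply: nneseries_ge0 => n _ _; rewrite lee_fin hcost_ge0.
apply: ge_ereal_sup => _ [dl0 /= dl00 <-].
apply/lee_addgt0Pr => eta eta0; rewrite add0e.
(* The three bounds give, in turn, a positive [- ln dl], a cover admissible for [dl0], and a final
   cost [dl] to the power [e / 2] of at most [eta]. *)
pose eps := Num.min (Num.min 2^-1 dl0) (eta `^ (2 / e)).
have eps0 : 0 < eps by rewrite !lt_min dl00 powR_gt0 //=; lra.
pose S := [set box_ratio d E delta | delta in [set delta : R | 0 < delta < eps]].
have : (ereal_inf S < (l + e / 2)%:E)%E.
  apply: (@le_lt_trans _ _ l%:E); last by rewrite lte_fin; lra.
  rewrite -E0; apply: ereal_sup_ubound; exists eps => //=; rewrite eps0 /=.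
  by rewrite !gt_min; apply/orP; left; apply/orP; left; lra.
case/ereal_inf_lt => _ [dl /= /andP[dlp dle] <-].
have [n [U [EU hU]]] := tb _ dlp.
have [N [V [_ NE EV hV]]] := covering_numberP _ _ _ _ _ _ _ EU hU.
move: dle; rewrite !lt_min => /andP[/andP[dl2 dldl0] dleta].
have L0 : 0 < - ln dl by rewrite oppr_gt0 ln_lt0 //; lra.
rewrite /box_ratio NE /= lte_fin ltr_pdivrMr // => hN.
have {}hN : N%:R <= dl `^ (- (l + e / 2)).
  case: N {NE EV} hN => [|N] hN; first by rewrite powR_ge0.
  rewrite -ler_ln ?posrE ?powR_gt0 // ln_powR ltW //.
  by rewrite (lt_le_trans hN) // mulrN mulNr.
apply: le_trans (@hausdorff_content_le _ _ _ _ dl _ _ N V d0 le0 _ EV hV) _.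
  by rewrite dlp ltW.
rewrite lee_fin (le_trans (ler_wpM2r (powR_ge0 _ _) hN)) //.
rewrite -powRD; last by rewrite (gt_eqF dlp) implybT.
have -> : - (l + e / 2) + (l + e) = e / 2 by field.
have -> : eta = (eta `^ (2 / e)) `^ (e / 2).
  rewrite -powRrM; have -> : 2 / e * (e / 2) = 1 by field; rewrite gt_eqF.
  by rewrite powRr1 // ltW.
by rewrite ge0_ler_powR ?nnegrE ?powR_ge0 ?(ltW dlp) ?(ltW dleta) //; lra.
Qed.

(** * The planar metric and the lower bound 1 for graphs *)

Lemma dist2_ge0 (R : realType) (p p' : R * R) : 0 <= dist2 p p'.
Proof. exact: sqrtr_ge0. Qed.

Lemma dist2_ge_fst (R : realType) (p p' : R * R) : `|p.1 - p'.1| <= dist2 p p'.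
Proof. by rewrite -sqrtr_sqr ler_wsqrtr // lerDl sqr_ge0. Qed.

Lemma dist2_le (R : realType) (p p' : R * R) :
  dist2 p p' <= `|p.1 - p'.1| + `|p.2 - p'.2|.
Proof.
rewrite -[leRHS]ger0_norm ?addr_ge0 // -sqrtr_sqr ler_wsqrtr //.
move: (p.1 - _) (p.2 - _) => u v.
rewrite -[u ^+ 2]real_normK ?num_real // -[v ^+ 2]real_normK ?num_real //.
by have := mulr_ge0 (normr_ge0 u) (normr_ge0 v); nra.
Qed.

(* Covering sets project onto intervals of length at most twice their
   diameter, and these intervals cover [0, 1]. *)
Lemma sum_hcost_graph_ge (R : realType) (g : R -> R) (s : R) (U : nat -> set (R * R)) :
  0 <= s <= 1 -> graph01 g `<=` \bigcup_i U i ->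
  (forall i, diam_le (@dist2 R) 1 (U i)) ->
  (1 <= 2%:E * \sum_(0 <= i <oo) (hcost (@dist2 R) s (U i))%:E)%E.
Proof.
move=> /andP[s0 s1] GU hU.
pose D i := diam (@dist2 R) (U i).
pose p i := xget (0, 0) (U i).
(* Centring at a chosen point with the diameter as radius captures the whole projection; this is the
   source of the factor 2. *)
pose V i : set R := if `[< U i = set0 >] then set0
  else [set` `[(p i).1 - D i, (p i).1 + D i]].
have hV i : U i !=set0 -> U i (p i) by move=> U0; exact: xgetPex.
rewrite -nneseriesZl; last by move=> i _; rewrite lee_fin hcost_ge0.
have -> : 1%E = lebesgue_measure ([set` `[0, 1] ] : set R).
  by rewrite lebesgue_measure_itv /= lte_fin ltr01 oppr0 adde0.
apply: (@le_trans _ _ (\sum_(0 <= i <oo) lebesgue_measure (V i))%E).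
  apply: measure_sigma_subadditive.
  - by move=> i; rewrite /V; case: ifP => _ //; exact: measurable_itv.
  - exact: measurable_itv.
  move=> t; rewrite /= in_itv /= => t01.
  have [i _ Ui] := GU (t, g t) (conj t01 erefl).
  exists i => //; rewrite /V; case: asboolP => [U0|_]; first by rewrite U0 in Ui.
  have Up : U i (p i) by apply: hV; exists (t, g t).
  rewrite /= in_itv /=.
  have := le_trans (dist2_ge_fst _ _ _) (le_diam _ _ _ _ _ _ _ (hU i) Ui Up).
  by rewrite ler_norml /= -/(D i); lra.
apply: lee_nneseries => [i _ _|i _]; first exact: measure_ge0.
rewrite /V /hcost; case: asboolP => [_|/eqP/set0P[x Ux]].
  by rewrite measure0 mule0.
have D0 : 0 <= D i by rewrite (le_trans (dist2_ge0 R x x)) // (@le_diam _ _ _ 1).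
have D1 : D i <= 1 by exact: diam_le_diam (hU i) Ux.
rewrite lebesgue_measure_itv /= -EFinM; case: ifP => _; last first.
  by rewrite lee_fin mulr_ge0 // powR_ge0.
rewrite -EFinB lee_fin.
(* For a base of at most 1, lowering the exponent from 1 to [s] cannot decrease the power; hence the
   choice of covers at scale 1. *)
have : D i <= D i `^ s.
  have [->|Dn0] := eqVneq (D i) 0; first exact: powR_ge0.
  rewrite -[leLHS]powRr1 // ger_powR // D1 andbT lt_neqAle eq_sym Dn0 //.
by rewrite -/(D i); lra.
Qed.

(** Vanishing measure at some exponent below 1 would give a cover at scale 1 of total cost less than
    1/2, too cheap for its projection to fill [0, 1]. *)
Lemma hausdorff_dim_graph_ge1 (R : realType) (g : R -> R) :
  (1%:E <= hausdorff_dim (@dist2 R) (graph01 g))%E.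
Proof.
apply: le_ereal_inf_tmp => _ [s [s0 hs] <-]; rewrite lee_fin leNgt; apply/negP => s1.
have : (hausdorff_content (@dist2 R) s 1 (graph01 g) < (2^-1)%:E)%E.
  apply: (@le_lt_trans _ _ 0%E); last by rewrite lte_fin invr_gt0.
  by rewrite -hs; apply: ereal_sup_ubound; exists 1 => //=.
case/ereal_inf_lt => _ [U [GU hU] <-] hlt.
have s01 : 0 <= s <= 1 by rewrite s0 ltW.
have := sum_hcost_graph_ge _ _ _ _ s01 GU hU.
apply/negP; rewrite -ltNge.
have -> : 1%E = (2%:E * (2^-1)%:E)%E :> \bar R by rewrite -EFinM mulfV.
by rewrite lte_pmul2l.
Qed.

(** * Box covers of Hölder graphs and the upper bound *)

Lemma holder_graph_cover (R : realType) (g : R -> R) (K sigma delta : R) :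
  0 <= K -> 0 < sigma <= 1 ->
  (forall x y, 0 <= x <= 1 -> 0 <= y <= 1 -> `|g x - g y| <= K * `|x - y| `^ sigma) ->
  0 < delta < 1 ->
  exists (n : nat) (U : nat -> set (R * R)),
    [/\ n%:R <= 3 * (4 * K + 1) * delta `^ (sigma - 2),
     graph01 g `<=` \bigcup_(i in [set i | (i < n)%N]) U i &
     forall i, diam_le (@dist2 R) delta (U i)].
Proof.
move=> K0 /andP[s0 s1] hg /andP[d0 d1].
(* There are [n1] columns of width at most [delta / 2]. Over each, [g] stays within [rho] of its
   value at the left end, and [m] boxes of height at most [delta / 2] fill this band of height
   [2 * rho]. *)
pose n1 := (Num.trunc (2 / delta)).+1; pose rho := K * delta `^ sigma.
pose m := (Num.trunc (4 * rho / delta)).+1.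
have dn0 : delta != 0 by rewrite gt_eqF.
have rho0 : 0 <= rho by rewrite mulr_ge0 // powR_ge0.
have n1p : 0 < n1%:R :> R by rewrite ltr0n.
have mp : 0 < m%:R :> R by rewrite ltr0n.
have n1lo : 2 / delta < n1%:R := truncnS_gt _.
have mlo : 4 * rho / delta < m%:R := truncnS_gt _.
(* The 1 added by rounding up is absorbed since [1 / delta] exceeds 1; for [m] below, since [delta]
   to the power [sigma - 1] is at least 1. *)
have n1hi : n1%:R <= 3 / delta.
  rewrite /n1 -[leLHS]natr1 (le_trans (lerD _ (lexx _)) (_ : 2 / delta + 1 <= _)) //.
    by rewrite truncn_le divr_ge0 // ltW.
  by rewrite ler_pdivlMr // mulrDl divfK ?gt_eqF //; lra.
have mhi : m%:R <= (4 * K + 1) * delta `^ (sigma - 1).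
  rewrite /m -[leLHS]natr1 [leRHS]mulrDl mul1r lerD //.
    have -> : 4 * K * delta `^ (sigma - 1) = 4 * rho / delta.
      by rewrite (powRB (r := sigma) (s := 1)) ?dn0 ?implybT // (powRr1 (ltW d0)) /rho !mulrA.
    by rewrite truncn_le !mulr_ge0 ?invr_ge0 ?(ltW d0) ?powR_ge0.
  by rewrite -[leLHS](powRr0 delta) ger_powR ?d0 ?(ltW d1) //; lra.
pose x i : R := i%:R / n1%:R.
pose z i j : R := g (x i) - rho + j%:R * (2 * rho / m%:R).
(* Box [k = i * m + j] is row [j] of column [i], recovered by quotient and remainder. *)
exists (n1 * m)%N, (fun k => [set p | x (k %/ m)%N <= p.1 <= x (k %/ m).+1 /\
   z (k %/ m)%N (k %% m)%N <= p.2 <= z (k %/ m)%N (k %% m).+1]).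
have xw i : x i.+1 - x i = n1%:R^-1 by rewrite /x -(natr1 i); field; rewrite gt_eqF.
have zw i j : z i j.+1 - z i j = 2 * rho / m%:R by rewrite /z -(natr1 j); ring.
have w1 : n1%:R^-1 <= delta / 2.
  by rewrite -[leRHS]invrK lef_pV2 ?posrE ?invr_gt0 ?divr_gt0 // invf_div ltW.
have w2 : 2 * rho / m%:R <= delta / 2.
  by move: mlo; rewrite ltr_pdivrMr // ler_pdivrMr //; lra.
split.
- rewrite natrM (le_trans (ler_pM _ _ n1hi mhi)) ?ler0n //.
  have -> : delta `^ (sigma - 2) = delta `^ (sigma - 1) / delta.
    have -> : sigma - 2 = sigma - 1 - 1 by ring.
    by rewrite (powRB (r := sigma - 1) (s := 1)) ?dn0 ?implybT // (powRr1 (ltW d0)).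
  by rewrite le_eqVlt; apply/orP; left; apply/eqP; ring.
- move=> [t _] [/= t01 ->].
  have [|i iN ti] := @partition_cell R n1 x t isT.
    by rewrite /x mul0r divff ?gt_eqF.
  have xi01 : 0 <= x i <= 1.
    by rewrite divr_ge0 ?ler0n //= ler_pdivrMr // mul1r ler_nat ltnW.
  have close : `|g t - g (x i)| <= rho.
    apply: le_trans (hg _ _ t01 xi01) _; rewrite ler_wpM2l //.
    rewrite ge0_ler_powR ?nnegrE ?(ltW s0) ?(ltW d0) //.
    by have := xw i; rewrite ger0_norm; lra.
  have [|j jm gj] := @partition_cell R m (z i) (g t) isT.
    rewrite /z mul0r addr0 mulrC divfK ?gt_eqF //.
    by move: close; rewrite ler_norml; lra.
  exists (i * m + j)%N => /=.
    by rewrite (leq_trans (_ : _ < i.+1 * m)%N) ?leq_mul2r ?iN ?orbT // mulSn addnC ltn_add2r.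
  by rewrite divnMDl // divn_small // addn0 modnMDl modn_small.
- move=> k p p' /= [p1 p2] [p'1 p'2].
  have xk := xw (k %/ m)%N; have zk := zw (k %/ m)%N (k %% m)%N.
  apply: le_trans (dist2_le _ _ _) _.
  have h1 : `|p.1 - p'.1| <= delta / 2 by rewrite ler_norml; lra.
  have h2 : `|p.2 - p'.2| <= delta / 2 by rewrite ler_norml; lra.
  lra.
Qed.

(** Provides the finite covers that [hausdorff_dim_le_lower_box] asks for at every scale; large
    scales reuse a cover at scale 1/2. *)
Lemma graph_totally_bounded (R : realType) (g : R -> R) (K sigma : R) :
  0 <= K -> 0 < sigma <= 1 ->
  (forall x y, 0 <= x <= 1 -> 0 <= y <= 1 -> `|g x - g y| <= K * `|x - y| `^ sigma) ->
  forall delta : R, 0 < delta -> exists (n : nat) (U : nat -> set (R * R)),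
    graph01 g `<=` \bigcup_(i in [set i | (i < n)%N]) U i /\
    forall i, diam_le (@dist2 R) delta (U i).
Proof.
move=> K0 s01 hg delta d0.
pose dl := Num.min delta 2^-1.
have dl01 : 0 < dl < 1.
  by rewrite lt_min d0 gt_min; apply/andP; split; [|apply/orP; right]; lra.
have [n [U [_ GU hU]]] := holder_graph_cover _ _ _ _ _ K0 s01 hg dl01.
exists n, U; split=> // i x y Ux Uy; apply: le_trans (hU i x y Ux Uy) _.
by rewrite ge_min lexx.
Qed.

(** The box count is at most [C] times [delta] to the power [sigma - 2]. After taking logarithms,
    [C] contributes [ln C / - ln delta], which falls below any [e] at small scales. *)
Lemma upper_box_dim_holder_graph (R : realType) (g : R -> R) (K sigma : R) :
  0 <= K -> 0 < sigma <= 1 ->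
  (forall x y, 0 <= x <= 1 -> 0 <= y <= 1 -> `|g x - g y| <= K * `|x - y| `^ sigma) ->
  (upper_box_dim (@dist2 R) (graph01 g) <= (2 - sigma)%:E)%E.
Proof.
move=> K0 s01 hg; apply/lee_addgt0Pr => e e0.
have /andP[s0 s1] := s01.
pose C := 3 * (4 * K + 1).
have C1 : 1 <= C by rewrite /C; lra.
have C0 : 0 < C by lra.
(* The exponential is the scale below which [ln C <= e * - ln dl]; the bound 1/2 keeps [- ln dl]
   positive. *)
pose eps := Num.min 2^-1 (expR (- (ln C / e))).
apply: ge_ereal_inf; exists (ereal_sup [set box_ratio (@dist2 R) (graph01 g) delta |
    delta in [set delta : R | 0 < delta < eps]]).
  exists eps => //=; rewrite lt_min expR_gt0 gt_min /=.
  by apply/andP; split; [|apply/orP; left]; lra.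
apply: ge_ereal_sup => _ [dl /= /andP[dl0 dleps] <-].
move: dleps; rewrite lt_min => /andP[dl2 dle].
have dl01 : 0 < dl < 1 by lra.
have [n [U [nle GU hU]]] := holder_graph_cover _ _ _ _ _ K0 s01 hg dl01.
have [N [V [Nn NE _ _]]] := covering_numberP _ _ _ _ _ _ _ GU hU.
have L0 : 0 < - ln dl by rewrite oppr_gt0 ln_lt0.
rewrite /box_ratio NE /= -EFinD lee_fin ler_pdivrMr //.
have {}dle : ln C <= e * - ln dl.
  move: dle; rewrite -ltr_ln ?posrE ?expR_gt0 // expRK ltrNr => dle.
  by rewrite mulrC -ler_pdivrMr // ltW.
move: C0 C1 nle; rewrite -/C; clearbody C => C0 C1 nle.
have : ln N%:R <= ln C + (2 - sigma) * - ln dl.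
  case: N Nn {NE} => [|N] Nn.
    by rewrite ln0 // addr_ge0 ?ln_ge0 // mulr_ge0 ?(ltW L0) //; lra.
  have -> : (2 - sigma) * - ln dl = ln (dl `^ (sigma - 2)) by rewrite ln_powR; ring.
  rewrite -lnM ?posrE ?powR_gt0 // ler_ln ?posrE ?mulr_gt0 ?powR_gt0 //.
  by apply: le_trans nle; rewrite ler_nat.
by move=> h; rewrite mulrDl; lra.
Qed.

Theorem theorem4p14 (R : realType) (q : nat) (M : 'I_q -> nat) (xs : 'I_q -> nat -> R)
  (sigma : R) (f alpha s F : ('I_q -> R) -> R) :
  (0 < q)%N ->
  partitions M xs ->
  0 < sigma <= 1 ->
  holder_on (@euclid_dist R q) (@cube R q) sigma f ->
  holder_on (@euclid_dist R q) (@cube R q) sigma alpha ->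
  holder_on (@euclid_dist R q) (@cube R q) sigma s ->
  (forall x, vertex x -> s x = f x) ->
  Num.max (sup_norm (@cube R q) alpha / (amin M xs) `^ sigma)
          (sup_norm (@cube R q) alpha + holder_seminorm (@euclid_dist R q) (@cube R q) sigma alpha) < 1 ->
  is_alpha_fractal M xs f alpha s F ->
  let g : R -> R := fun t => F (fun k : 'I_q => if val k == 0%N then t else 0) in
  let G := graph01 g in
  [/\ holder_on (fun x y : R => `|x - y|) [set t : R | 0 <= t <= 1] sigma g,
      (1%:E <= hausdorff_dim (@dist2 R) G)%E,
      (hausdorff_dim (@dist2 R) G <= lower_box_dim (@dist2 R) G)%E,
      (lower_box_dim (@dist2 R) G <= upper_box_dim (@dist2 R) G)%E &
      (upper_box_dim (@dist2 R) G <= (2 - sigma)%:E)%E].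
Proof.
move=> q0 hp s01 hf halpha hs _; rewrite gt_max => /andP[Aa _] hF g G.
have /andP[s0 _] := s01.
have hg := fractal_axis_holder _ _ _ _ _ _ _ _ _ q0 hp s0 hf halpha hs Aa hF.
have [K K0 hK] := holder_on_nneg _ _ _ _ _ _ hg.
split.
- exact: hg.
- exact: hausdorff_dim_graph_ge1.
- apply: hausdorff_dim_le_lower_box; first exact: dist2_ge0.
  by apply: graph_totally_bounded K0 s01 _ => x y x01 y01; exact: hK.
- exact: lower_box_dim_le_upper.
- by apply: upper_box_dim_holder_graph K0 s01 _ => x y x01 y01; exact: hK.
Qed.
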